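(* Let $\mathscr C$ be a finite skeletal EI-category and $k$ a field such that, for each object $c$, the characteristic of $k$ does not divide $|\mathscr C(c,c)|$ and $k$ is a splitting field for $\mathscr C(c,c)$. Then the vertex set of $Q(k\mathscr C)$ is $\coprod_{c\in\mathscr C^0}\mathrm{Irr}(\mathscr C(c,c))$, and for $U\in\mathrm{Irr}(\mathscr C(c,c))$, $V\in\mathrm{Irr}(\mathscr C(c',c'))$ the number of arrows from $U$ to $V$ is the multiplicity of $V\otimes_kU^*$ as an irreducible constituent of the $\mathscr C(c',c')\times\mathscr C(c,c)$-module $k[\mathrm{Irr}_{\mathscr C}(c,c')]$.
   Context: $\mathscr C^0$ is the object set of the finite category $\mathscr C$. The category algebra $k\mathscr C$ has basis the arrows of $\mathscr C$, with product the composition when defined and $0$ otherwise. $\mathscr C$ is an EI-category if every endomorphism is an isomorphism (so each $\mathscr C(c,c)$ is a group); it is skeletal if distinct objects are non-isomorphic. A morphism is irreducible if it is neither a split monomorphism nor a split epimorphism and whenever it factors as $gh$, either $h$ is a split monomorphism or $g$ is a split epimorphism; $\mathrm{Irr}_{\mathscr C}(c,c')$ is the set of irreducible morphisms $c\to c'$, on which $\mathscr C(c',c')\times\mathscr C(c,c)$ acts by $(g,h)f=gfh^{-1}$. $U^*$ is the contragredient; the quiver has $\dim\mathrm{Ext}^1(S,T)$ arrows from $S$ to $T$. *)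

(* Defs.v *)
From HB Require Import structures.
From mathcomp Require Import all_boot all_order all_algebra.
From mathcomp Require Import mxtens.
Set Implicit Arguments.
Unset Strict Implicit.
Unset Printing Implicit Defensive.
Import Order.TTheory GRing.Theory Num.Theory.
Local Open Scope ring_scope.

(* Finite categories: a finite type of objects, a finite type of all   *)
(* arrows with source/target maps, identities and a (total, junk when  *)
(* not composable) composition  comp g f = g \o f.                     *)
Record fincat := FinCat {
  ob : finType;
  arr : finType;
  src : arr -> ob;
  tgt : arr -> ob;
  idm : ob -> arr;
  comp : arr -> arr -> arr
}.

Section Cat.
Variable C : fincat.
Local Notation arr := (arr C).
Local Notation ob := (ob C).
Local Notation src := (@src C).
Local Notation tgt := (@tgt C).
Local Notation idm := (@idm C).
Local Notation comp := (@comp C).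

Definition is_category : Prop :=
  (forall c, src (idm c) = c /\ tgt (idm c) = c) /\
  (forall g f, tgt f = src g -> src (comp g f) = src f /\ tgt (comp g f) = tgt g) /\
  (forall f, comp f (idm (src f)) = f /\ comp (idm (tgt f)) f = f) /\
  (forall h g f, tgt f = src g -> tgt g = src h ->
     comp h (comp g f) = comp (comp h g) f).

Definition is_EI : Prop :=
  forall a, src a = tgt a ->
    exists b, src b = tgt a /\ tgt b = src a /\
              comp a b = idm (tgt a) /\ comp b a = idm (src a).

Definition is_skeletal : Prop :=
  forall f g, src g = tgt f -> tgt g = src f ->
    comp g f = idm (src f) -> comp f g = idm (tgt f) -> src f = tgt f.

Definition endo (c : ob) : {set arr} := [set a | (src a == c) && (tgt a == c)].

Definition inv (a : arr) : arr :=
  odflt a [pick b | (src b == tgt a) && (tgt b == src a) &&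
                    (comp a b == idm (tgt a)) && (comp b a == idm (src a))].

Definition split_mono (f : arr) : bool :=
  [exists r, (src r == tgt f) && (tgt r == src f) && (comp r f == idm (src f))].
Definition split_epi (f : arr) : bool :=
  [exists s, (src s == tgt f) && (tgt s == src f) && (comp f s == idm (tgt f))].

Definition irreducible_mor (f : arr) : bool :=
  ~~ split_mono f && ~~ split_epi f &&
  [forall g, forall h,
     ((src h == src f) && (tgt h == src g) && (tgt g == tgt f) && (comp g h == f))
     ==> (split_mono h || split_epi g)].

Definition IrrMor (c c' : ob) : {set arr} :=
  [set f | (src f == c) && (tgt f == c') && irreducible_mor f].

Variable F : fieldType.

(* A finite dimensional (left) kC-module of dimension n, written with   *)
(* row vectors and right matrix action: v |-> v *m rho a  is  a . v.    *)
Definition cat_rep n (rho : arr -> 'M[F]_n) : Prop :=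
  (forall f g, rho f *m rho g = if tgt f == src g then rho (comp g f) else 0) /\
  \sum_(c : ob) rho (idm c) = 1%:M.

Definition grp_rep (c : ob) n (sigma : arr -> 'M[F]_n) : Prop :=
  sigma (idm c) = 1%:M /\
  forall f g, f \in endo c -> g \in endo c -> sigma f *m sigma g = sigma (comp g f).

Definition infl (c : ob) n (sigma : arr -> 'M[F]_n) : arr -> 'M[F]_n :=
  fun a => if (src a == c) && (tgt a == c) then sigma a else 0.

Definition kIrr (c c' : ob) (gh : arr * arr) : 'M[F]_#|IrrMor c c'| :=
  \matrix_(i, j) (enum_val j == comp gh.1 (comp (enum_val i) (inv gh.2)) :> arr)%:R.

Definition tens_dual n m (sigmaU : arr -> 'M[F]_n) (sigmaV : arr -> 'M[F]_m)
  (gh : arr * arr) : 'M[F]_(m * n) :=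
  tensmx (sigmaV gh.1) (sigmaU (inv gh.2))^T.

End Cat.

Section Modules.
Variables (F : fieldType) (X : finType) (A : {set X}).

Definition invariant d (M : X -> 'M[F]_d) (U : 'M[F]_d) : Prop :=
  forall x, x \in A -> (U *m M x <= U)%MS.

Definition simple_on d (M : X -> 'M[F]_d) : Prop :=
  (0 < d)%N /\
  forall U : 'M[F]_d, invariant M U -> (U == (0 : 'M[F]_d))%MS \/ row_full U.

Definition iso_on d d' (M : X -> 'M[F]_d) (M' : X -> 'M[F]_d') : Prop :=
  exists P : 'M[F]_(d, d'), [/\ row_free P, row_full P &
     forall x, x \in A -> M x *m P = P *m M' x].

Definition comp_series d (M : X -> 'M[F]_d) (l : nat) (U : nat -> 'M[F]_d) : Prop :=
  [/\ (U 0%N == (0 : 'M[F]_d))%MS, row_full (U l),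
      (forall i, (i <= l)%N -> invariant M (U i)) &
      (forall i, (i < l)%N -> (U i < U i.+1)%MS /\
         forall Y : 'M[F]_d, invariant M Y -> (U i <= Y)%MS -> (Y <= U i.+1)%MS ->
           (Y == U i)%MS \/ (Y == U i.+1)%MS)].

(* the factor U1/U0 is isomorphic to the module W *)
Definition factor_iso w d (W : X -> 'M[F]_w) (M : X -> 'M[F]_d) (U0 U1 : 'M[F]_d) : Prop :=
  exists P : 'M[F]_(w, d),
    [/\ row_free P, ((U0 + P)%MS == U1)%MS, ((P :&: U0)%MS == (0 : 'M[F]_d))%MS &
        forall x, x \in A -> (W x *m P - P *m M x <= U0)%MS].

Definition multiplicity_is w d (W : X -> 'M[F]_w) (M : X -> 'M[F]_d) (r : nat) : Prop :=
  (exists l U, comp_series M l U) /\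
  forall l U, comp_series M l U ->
    exists I : {set 'I_l}, #|I| = r /\
      forall i : 'I_l, i \in I <-> factor_iso W M (U i) (U i.+1).

End Modules.

(* Ext^1 between finite dimensional kC-modules S (dim n) and T (dim m): *)
(* extensions 0 -> T -> E -> S -> 0 are E = T (+) S with action          *)
(*   [[tau a, 0], [delta a, rho a]] ; delta ranges over the cocycles    *)
(* Z, split extensions correspond to coboundaries B, Ext^1 = Z / B.     *)
Section Ext.
Variables (C : fincat) (F : fieldType) (n m : nat).
Variables (rho : arr C -> 'M[F]_n) (tau : arr C -> 'M[F]_m).

Definition cocycle_defect (delta : {ffun arr C -> 'M[F]_(n, m)}) :
  {ffun (arr C * arr C) -> 'M[F]_(n, m)} * 'M[F]_(n, m) :=
  ([ffun p : arr C * arr C =>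
     (if tgt p.1 == src p.2 then delta (comp p.2 p.1) else 0)
     - (delta p.1 *m tau p.2 + rho p.1 *m delta p.2)],
   \sum_(c : ob C) delta (idm c)).

Definition coboundary (B : 'M[F]_(n, m)) : {ffun arr C -> 'M[F]_(n, m)} :=
  [ffun a => rho a *m B - B *m tau a].

Definition cocycles : {vspace {ffun arr C -> 'M[F]_(n, m)}} :=
  lker (linfun cocycle_defect).
Definition coboundaries : {vspace {ffun arr C -> 'M[F]_(n, m)}} :=
  limg (linfun coboundary).

Definition dimExt1 : nat := (\dim cocycles - \dim coboundaries)%N.

End Ext.

(* Main.v *)
From HB Require Import structures.
From mathcomp Require Import all_boot all_order all_algebra.
From mathcomp Require Import mxtens.
From Stdlib Require Import Classical_Prop.
Require Import Defs.
Set Implicit Arguments.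
Unset Strict Implicit.
Unset Printing Implicit Defensive.
Import GRing.Theory.
Local Open Scope ring_scope.

(* In a skeletal EI-category the arrows order the objects, so on a simple module only one
   object acts nontrivially, namely a last one in its support.  A cocycle between the
   inflations of U at c and V at c' is determined, modulo coboundaries, by its values on
   Irr(c,c'): it can be normalised to vanish on identities, and then it is equivariant and
   kills every arrow that factors through a third object.  (For c = c' there are no
   irreducible arrows, and averaging shows that every cocycle is a coboundary.)  Hence
   Ext^1(U,V) = Hom(k[Irr(c,c')], W) for W the tensor product of V and the dual of U.  By Maschke
   and Schur this Hom loses exactly one dimension at each composition factor isomorphic to W. *)

(** * Automorphisms, split arrows and irreducible arrows *)

Section Category.
Variable C : fincat.
Hypotheses (catC : is_category C) (EIC : is_EI C) (skelC : is_skeletal C).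
Implicit Types (c x : ob C) (f g h a : arr C).

Lemma src_idm c : src (idm c) = c. Proof. by case: catC => H _; case: (H c). Qed.
Lemma tgt_idm c : tgt (idm c) = c. Proof. by case: catC => H _; case: (H c). Qed.
Lemma src_comp g f : tgt f = src g -> src (comp g f) = src f.
Proof. by case: catC => _ [H _] /H[]. Qed.
Lemma tgt_comp g f : tgt f = src g -> tgt (comp g f) = tgt g.
Proof. by case: catC => _ [H _] /H[]. Qed.
Lemma comp_idr f : comp f (idm (src f)) = f.
Proof. by case: catC => _ [_ [H _]]; case: (H f). Qed.
Lemma comp_idl f : comp (idm (tgt f)) f = f.
Proof. by case: catC => _ [_ [H _]]; case: (H f). Qed.
Lemma comp_idm c : comp (idm c) (idm c) = idm c.
Proof. by have := comp_idr (idm c); rewrite src_idm. Qed.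
Lemma compA h g f : tgt f = src g -> tgt g = src h ->
  comp h (comp g f) = comp (comp h g) f.
Proof. by case: catC => _ [_ [_ H]]; apply: H. Qed.

Lemma endoP c a : reflect (src a = c /\ tgt a = c) (a \in endo c).
Proof.
by rewrite inE; apply: (iffP andP) => -[/eqP-> /eqP->].
Qed.

Lemma idm_endo c : idm c \in endo c.
Proof. by apply/endoP; rewrite src_idm tgt_idm. Qed.

Lemma comp_endo c f g : f \in endo c -> g \in endo c -> comp g f \in endo c.
Proof.
move=> /endoP[sf tf] /endoP[sg tg]; apply/endoP.
by rewrite src_comp ?tgt_comp ?tf ?sg.
Qed.

Lemma inv_spec c a : a \in endo c ->
  [/\ inv a \in endo c, comp a (inv a) = idm c & comp (inv a) a = idm c].
Proof.
move=> /endoP[sa ta]; rewrite /inv; case: pickP => [b | no].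
  move=> /andP[/andP[/andP[/eqP sb /eqP tb] /eqP ab] /eqP ba] /=.
  by split; [apply/endoP; rewrite sb tb | rewrite ab ta | rewrite ba sa].
have [|b [sb [tb [ab ba]]]] := EIC (a := a); first by rewrite sa ta.
by have := no b; rewrite sb tb ab ba !eqxx.
Qed.

Lemma inv_endo c a : a \in endo c -> inv a \in endo c.
Proof. by case/inv_spec. Qed.
Lemma comp_inv_r c a : a \in endo c -> comp a (inv a) = idm c.
Proof. by case/inv_spec. Qed.
Lemma comp_inv_l c a : a \in endo c -> comp (inv a) a = idm c.
Proof. by case/inv_spec. Qed.

Lemma comp_endo_injr c f g g' : f \in endo c -> src g = c -> src g' = c ->
  comp g f = comp g' f -> g = g'.
Proof.
move=> fc sg sg' /(congr1 (fun a => comp a (inv f))).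
have [sf tf] := endoP _ _ fc; have [si ti] := endoP _ _ (inv_endo fc).
rewrite -!compA ?ti ?tf ?sg ?sg' // (comp_inv_r fc) -{1}sg -{1}sg'.
by rewrite !comp_idr.
Qed.

(** [inv] is the result of a search, so formulas for it are obtained from uniqueness; a one-sided
    inverse suffices because endomorphisms can be cancelled. *)
Lemma inv_uniq c a b : a \in endo c -> src b = c -> tgt b = c ->
  comp b a = idm c -> b = inv a.
Proof.
move=> ac sb tb ba; apply: (comp_endo_injr ac) => //.
  by case/endoP: (inv_endo ac).
by rewrite ba (comp_inv_l ac).
Qed.

Lemma inv_idm c : inv (idm c) = idm c.
Proof.
apply/esym/(inv_uniq (idm_endo c)); rewrite ?src_idm ?tgt_idm //.
by rewrite comp_idm.
Qed.

Lemma inv_comp c f g : f \in endo c -> g \in endo c ->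
  inv (comp g f) = comp (inv f) (inv g).
Proof.
move=> fc gc; have fi := inv_endo fc; have gi := inv_endo gc.
have /endoP[sc tc] := comp_endo gi fi.
apply/esym/(inv_uniq (comp_endo fc gc)) => //.
case/endoP: (fc) (gc) (fi) (gi) => sf tf /endoP[sg tg] /endoP[sfi tfi] /endoP[sgi tgi].
rewrite compA ?src_comp ?tgt_comp ?tf ?sg ?tg ?sgi ?tgi ?sfi ?tfi //.
rewrite -(compA (h := inv f)) ?tg ?sgi ?tgi ?sfi // (comp_inv_l gc).
by rewrite -{1}sfi comp_idr (comp_inv_l fc).
Qed.

Lemma inv_inv c a : a \in endo c -> inv (inv a) = a.
Proof.
move=> ac; case/endoP: (ac) => sa ta.
by apply/esym/(inv_uniq (inv_endo ac)) => //; rewrite (comp_inv_r ac).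
Qed.

(* [f r] is an idempotent of the group of automorphisms of [tgt f], so it is the identity. *)
Lemma split_mono_src_tgt f : split_mono f -> src f = tgt f.
Proof.
move=> /existsP[r /andP[/andP[/eqP sr /eqP tr] /eqP rf]].
have afr : comp f r \in endo (tgt f) by apply/endoP; rewrite src_comp ?tgt_comp.
apply: (skelC sr tr rf); have [sa ta] := endoP _ _ afr.
apply: (comp_endo_injr afr); rewrite ?src_idm //.
have -> : comp (idm (tgt f)) (comp f r) = comp f r by rewrite -{1}ta comp_idl.
by rewrite compA ?sa // -(compA (h := f)) // rf comp_idr.
Qed.

(** Skeletality gives one direction and the EI property the other, so splitting depends only on the
    two end objects. *)
Lemma split_monoE f : split_mono f = (src f == tgt f).
Proof.
apply/idP/eqP => [|sf]; first exact: split_mono_src_tgt.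
have [b [sb [tb [_ bf]]]] := EIC sf.
by apply/existsP; exists b; rewrite sb tb bf !eqxx.
Qed.

Lemma split_epiE f : split_epi f = (src f == tgt f).
Proof.
apply/idP/eqP => [/existsP[s /andP[/andP[/eqP ss /eqP ts] /eqP fs]]|sf].
  rewrite -ss -ts; apply/esym/split_mono_src_tgt/existsP; exists f.
  by rewrite ss ts fs !eqxx.
have [b [sb [tb [fb _]]]] := EIC sf.
by apply/existsP; exists b; rewrite sb tb fb !eqxx.
Qed.

(** As the split arrows are exactly the endomorphisms, irreducibility becomes a condition on the
    middle object of each factorization. *)
Lemma IrrMorP c c' f :
  f \in IrrMor c c' <->
  [/\ src f = c, tgt f = c', c <> c' &
      forall g h, src h = c -> tgt h = src g -> tgt g = c' -> comp g h = f ->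
        src g = c \/ src g = c'].
Proof.
rewrite inE /irreducible_mor split_monoE split_epiE andbb; split.
  move=> /andP[/andP[/eqP sf /eqP tf] /andP[/eqP ne /forallP irr]].
  split=> // [|g h sh th tg gh]; first by rewrite -sf -tf.
  have /forallP/(_ h)/implyP := irr g.
  rewrite sf tf sh th tg gh !eqxx => /(_ isT).
  by rewrite split_monoE split_epiE sh th tg => /orP[]/eqP; [left|right].
move=> [-> -> /eqP ne irr]; rewrite !eqxx ne /=.
apply/forallP => g; apply/forallP => h; apply/implyP.
move=> /andP[/andP[/andP[/eqP sh /eqP th] /eqP tg] /eqP gh].
rewrite split_monoE split_epiE sh th tg.
by have [->|->] := irr g h sh th tg gh; rewrite eqxx ?orbT.
Qed.

Lemma IrrMor_src c c' f : f \in IrrMor c c' -> src f = c.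
Proof. by case/IrrMorP. Qed.
Lemma IrrMor_tgt c c' f : f \in IrrMor c c' -> tgt f = c'.
Proof. by case/IrrMorP. Qed.

(** A factorization [u v] of [g f] turns into the factorization of [f] by [inv g u] and [v], with
    the same middle object. *)
Lemma IrrMor_compl c c' f g : g \in endo c' -> tgt f = c' ->
  (comp g f \in IrrMor c c') = (f \in IrrMor c c').
Proof.
have aux f1 g1 : g1 \in endo c' -> f1 \in IrrMor c c' -> comp g1 f1 \in IrrMor c c'.
  move=> g1c /IrrMorP[sf tf ne irr]; case/endoP: (g1c) => sg tg.
  apply/IrrMorP; rewrite src_comp ?tgt_comp ?tf ?sg //; split=> // u v sv tv tu uv.
  case/endoP: (inv_endo g1c) => si ti.
  rewrite -(src_comp (g := inv g1) (f := u)) ?tu ?si //.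
  apply: (irr _ v) => //; rewrite ?src_comp ?tgt_comp ?tu ?si //.
  rewrite -compA ?tu ?si // uv compA ?tf ?sg ?tg ?si // (comp_inv_l g1c).
  by rewrite -tf comp_idl.
move=> gc tf; apply/idP/idP; last exact: aux.
case/endoP: (gc) => sg tg; case/endoP: (inv_endo gc) => si ti.
move/(aux _ _ (inv_endo gc)); rewrite compA ?tf ?sg ?tg ?si // (comp_inv_l gc).
by rewrite -tf comp_idl.
Qed.

Lemma IrrMor_compr c c' f h : h \in endo c -> src f = c ->
  (comp f h \in IrrMor c c') = (f \in IrrMor c c').
Proof.
have aux f1 h1 : h1 \in endo c -> f1 \in IrrMor c c' -> comp f1 h1 \in IrrMor c c'.
  move=> h1c /IrrMorP[sf tf ne irr]; case/endoP: (h1c) => sh th.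
  apply/IrrMorP; rewrite src_comp ?tgt_comp ?th ?sf //; split=> // u v sv tv tu uv.
  case/endoP: (inv_endo h1c) => si ti.
  apply: (irr u (comp v (inv h1))) => //; rewrite ?src_comp ?tgt_comp ?sv ?ti //.
  rewrite compA ?ti ?sv // uv -compA ?ti ?sh ?th ?sf // (comp_inv_r h1c).
  by rewrite -sf comp_idr.
move=> hc sf; apply/idP/idP; last exact: aux.
case/endoP: (hc) => sh th; case/endoP: (inv_endo hc) => si ti.
move/(aux _ _ (inv_endo hc)); rewrite -compA ?ti ?sh ?th ?sf // (comp_inv_r hc).
by rewrite -sf comp_idr.
Qed.

Lemma IrrMor_act c c' f g h : g \in endo c' -> h \in endo c -> f \in IrrMor c c' ->
  comp g (comp f h) \in IrrMor c c'.
Proof.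
move=> gc hc fI; have sf := IrrMor_src fI; have tf := IrrMor_tgt fI.
case/endoP: (hc) => _ th.
by rewrite IrrMor_compl ?tgt_comp ?th ?sf // IrrMor_compr.
Qed.

End Category.

(** * Matrix representations: averaging, Maschke's theorem and a converse of Schur's lemma *)

Lemma invmx_mul (F : fieldType) n (A B : 'M[F]_n) :
  A \in unitmx -> B \in unitmx -> invmx (A *m B) = invmx B *m invmx A.
Proof.
move=> uA uB; have uAB : A *m B \in unitmx by rewrite unitmx_mul uA.
by rewrite -[RHS]mulmx1 -(mulmxV uAB) !mulmxA mulmxKV // mulVmx // mul1mx.
Qed.

Lemma submx_mul_eq0 (F : fieldType) m1 m2 n p
    (A : 'M[F]_(m1, n)) (B : 'M_(m2, n)) (C : 'M_(n, p)) :
  (A <= B)%MS -> B *m C = 0 -> A *m C = 0.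
Proof. by case/submxP => D -> BC0; rewrite -mulmxA BC0 mulmx0. Qed.

Section GroupRepresentations.
Variables (F : fieldType) (X : finType) (A : {set X}) (op : X -> X -> X).

(* As much of a group structure on [A] as averaging needs. *)
Definition translations_permute : Prop :=
  {in A &, forall x y, op x y \in A} /\ {in A, forall x, {in A &, injective (op x)}}.

(** Invertibility takes the place of a condition at a unit: [invmx (M x)] plays the role of the
    action of the inverse of [x]. *)
Definition mat_rep d (M : X -> 'M[F]_d) : Prop :=
  {in A &, forall x y, M x *m M y = M (op x y)} /\
  {in A, forall x, M x \in unitmx}.

Hypotheses (opA : translations_permute) (cardA : #|A|%:R != 0 :> F).

Lemma reindex_translation (V : nmodType) (f : X -> V) x : x \in A ->
  \sum_(y in A) f (op x y) = \sum_(y in A) f y.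
Proof.
case: opA => clA injA xA.
have imA : op x @: A = A.
  apply/eqP; rewrite eqEcard card_in_imset ?leqnn; last exact: injA.
  by rewrite andbT; apply/subsetP => _ /imsetP[y yA ->]; apply: clA.
by rewrite -[in RHS]imA big_imset //=; apply: injA.
Qed.

Definition intertwines d w (M : X -> 'M[F]_d) (W : X -> 'M[F]_w) (Q : 'M[F]_(d, w)) :=
  [forall x in A, M x *m Q == Q *m W x].

Lemma intertwinesP d w (M : X -> 'M[F]_d) (W : X -> 'M[F]_w) Q :
  reflect (forall x, x \in A -> M x *m Q = Q *m W x) (intertwines M W Q).
Proof. by apply: (iffP forall_inP) => H x /H /eqP. Qed.

Definition average d w (M : X -> 'M[F]_d) (W : X -> 'M[F]_w) (Q : 'M[F]_(d, w)) :=
  #|A|%:R^-1 *: \sum_(x in A) M x *m Q *m invmx (W x).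

(** Reindexing the sum by [op y] brings [M y] out on the left and cancels [W y] on the right. *)
Lemma average_intertwines d w (M : X -> 'M[F]_d) (W : X -> 'M[F]_w) Q :
  mat_rep M -> mat_rep W -> intertwines M W (average M W Q).
Proof.
move=> [Mop Mu] [Wop Wu]; apply/intertwinesP => y yA.
rewrite -scalemxAr -scalemxAl; congr (_ *: _).
rewrite -[in RHS](reindex_translation (fun x => M x *m Q *m invmx (W x)) yA).
rewrite mulmx_sumr mulmx_suml; apply: eq_bigr => x xA.
rewrite -Mop // -Wop // invmx_mul ?Wu // -!mulmxA mulVmx ?Wu // mulmx1.
by rewrite !mulmxA.
Qed.

(** All summands become equal to [Z], and the invertibility of [#|A|] in [F] turns their sum back
    into [Z]. *)
Lemma average_fix d w k (M : X -> 'M[F]_d) (W : X -> 'M[F]_w) Q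
    (V : 'M[F]_(k, d)) (Z : 'M[F]_(k, w)) :
  (forall x, x \in A -> V *m M x *m Q *m invmx (W x) = Z) -> V *m average M W Q = Z.
Proof.
move=> H; rewrite -scalemxAr mulmx_sumr (eq_bigr (fun=> Z)) => [|x xA].
  by rewrite sumr_const -scaler_nat scalerA mulVf // scale1r.
by rewrite -(H x xA) !mulmxA.
Qed.

(** [U *m M x] has the same rank as [U], so the inclusion is an equality and may be multiplied by
    the inverse. *)
Lemma invariant_invmx d (M : X -> 'M[F]_d) (U : 'M[F]_d) x :
  mat_rep M -> invariant A M U -> x \in A -> (U *m invmx (M x) <= U)%MS.
Proof.
move=> [_ Mu] UM xA.
have /eqmxP/eqmxMr/eqmxP : (U *m M x == U)%MS.
  by rewrite -(mxrank_leqif_eq (UM x xA)).2 mxrankMfree // row_free_unit Mu.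
by move/(_ _ (invmx (M x)))/andP => [_]; rewrite mulmxK ?Mu.
Qed.

Lemma maschke d (M : X -> 'M[F]_d) (U : 'M[F]_d) :
  mat_rep M -> invariant A M U ->
  exists p : 'M[F]_d, [/\ intertwines M M p, (p <= U)%MS & U *m p = U].
Proof.
(* [pinvmx U *m U] has its image in [U] and is the identity there; averaging keeps both properties
   and adds equivariance. *)
move=> Mrep UM; exists (average M M (pinvmx U *m U)); split.
- exact: average_intertwines.
- apply/scalemx_sub/summx_sub => x xA.
  rewrite mulmxA -mulmxA; apply: mulmx_sub.
  exact: invariant_invmx.
- apply: average_fix => x xA; rewrite mulmxA mulmxKpV ?UM //.
  by rewrite mulmxK //; apply: Mrep.2.
Qed.

(** The Maschke projection onto an invariant [U] is a scalar: [U] is zero when this scalar is 0, and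
    is everything otherwise. *)
Lemma simple_of_scalar_endomorphisms d (M : X -> 'M[F]_d) :
  (0 < d)%N -> mat_rep M ->
  (forall B, intertwines M M B -> exists a, B = a%:M) -> simple_on A M.
Proof.
move=> d0 Mrep Mend; split=> // U UM.
have [p [/Mend[a ->] pU Up]] := maschke Mrep UM.
have [a0|a0] := eqVneq a 0; [left | right].
  by rewrite -Up a0 mul_mx_scalar scale0r submx_refl.
by rewrite -sub1mx; apply: submx_trans pU; rewrite -(eqmx_scale _ a0) scalemx1.
Qed.

End GroupRepresentations.

(** * Existence of composition series *)

Section CompositionSeries.
Variables (F : fieldType) (X : finType) (A : {set X}) (d : nat) (M : X -> 'M[F]_d).
Implicit Types U Y Z : 'M[F]_d.

(** Descent on the rank of [Y]; excluded middle decides whether some invariant subspace lies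
    strictly between [U] and [Y]. *)
Lemma minimal_overmodule U Y : invariant A M Y -> (U < Y)%MS ->
  exists Y', [/\ invariant A M Y', (U < Y')%MS &
    forall Z, invariant A M Z -> (U <= Z)%MS -> (Z <= Y')%MS ->
      (Z == U)%MS \/ (Z == Y')%MS].
Proof.
have [k] := ubnP (\rank Y); elim: k Y => // k IH Y rY YM UY.
case: (classic (exists Z, [/\ invariant A M Z, (U < Z)%MS & (Z < Y)%MS])).
  case=> Z [ZM UZ ZY]; apply: (IH Z) => //.
  exact: leq_trans (rank_ltmx ZY) _.
move=> no; exists Y; split=> // Z ZM UZ ZY.
have [ZU|nZU] := boolP (Z <= U)%MS; first by left; apply/andP.
have [YZ|nYZ] := boolP (Y <= Z)%MS; first by right; apply/andP.
by case: no; exists Z; rewrite !ltmxE UZ ZY nZU nYZ.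
Qed.

Lemma comp_series_exists : exists l (U : nat -> 'M[F]_d), comp_series A M l U.
Proof.
(* A chain is built upwards from an arbitrary invariant [U], by induction on the codimension of
   [U]. *)
suff: forall U, invariant A M U -> exists l (V : nat -> 'M[F]_d),
  [/\ V 0%N = U, row_full (V l), (forall i, (i <= l)%N -> invariant A M (V i)) &
      (forall i, (i < l)%N -> (V i < V i.+1)%MS /\
         forall Y : 'M[F]_d, invariant A M Y -> (V i <= Y)%MS -> (Y <= V i.+1)%MS ->
           (Y == V i)%MS \/ (Y == V i.+1)%MS)].
  case/(_ 0) => [x xA|l [V [V0 Vl VM Vs]]]; first by rewrite mul0mx.
  by exists l, V; split=> //; rewrite V0 submx_refl.
move=> U; have [k] := ubnP (d - \rank U); elim: k U => // k IH U rU UM.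
have [Uf|nUf] := boolP (row_full U).
  by exists 0%N, (fun=> U); split=> // i; rewrite leqn0 => /eqP->.
have [||Y [YM UY Ymin]] := @minimal_overmodule U 1%:M.
- by move=> x _; rewrite submx1.
- by rewrite ltmxE submx1 sub1mx.
have [|//|l [V [V0 Vl VM Vs]]] := IH Y.
  have rUY : (\rank U < \rank Y)%N by apply: rank_ltmx.
  apply: (leq_trans (n := d - \rank U)); last by rewrite -ltnS.
  by rewrite ltn_sub2l //; apply: leq_trans (rank_leq_col Y).
exists l.+1, (fun i => if i is j.+1 then V j else U); split=> //.
  by case=> // i; apply: VM.
case=> [_|i]; last exact: Vs.
by rewrite V0.
Qed.

End CompositionSeries.

(** * Multiplicity of a simple module as the dimension of a space of homomorphisms *)

Section Multiplicity.
Variables (F : fieldType) (X : finType) (A : {set X}) (op : X -> X -> X).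
Hypotheses (opA : translations_permute A op) (cardA : #|A|%:R != 0 :> F).
Variables (d w : nat) (M : X -> 'M[F]_d) (W : X -> 'M[F]_w).
Hypotheses (Mrep : mat_rep A op M) (Wrep : mat_rep A op W) (Wsimple : simple_on A W).
Hypothesis Wend : forall B, intertwines A W W B -> exists a, B = a%:M.
Implicit Types (U : 'M[F]_d) (phi psi : 'M[F]_(d, w)).

Definition intertwiners : {vspace 'M[F]_(d, w)} :=
  (\bigcap_(x in A) lker (linfun (mulmx (M x) \- mulmxr (W x))))%VS.

Lemma mem_intertwiners phi : (phi \in intertwiners) = intertwines A M W phi.
Proof.
apply/idP/intertwinesP => [/subv_bigcapP H x xA | H].
  have := H x xA; rewrite -memvE memv_ker lfunE /= subr_eq0.
  by move/eqP.
apply/subv_bigcapP => x xA.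
by rewrite -memvE memv_ker lfunE /= subr_eq0 H.
Qed.

(** For invariant [U] this is Hom(M/U, W). *)
Definition intertwiners_killing U : {vspace 'M[F]_(d, w)} :=
  (intertwiners :&: lker (linfun (mulmx U)))%VS.

Lemma intertwiners_killingP U phi :
  reflect ((forall x, x \in A -> M x *m phi = phi *m W x) /\ U *m phi = 0)
          (phi \in intertwiners_killing U).
Proof.
rewrite memv_cap mem_intertwiners memv_ker lfunE /=.
by apply: (iffP andP) => -[/intertwinesP H /eqP].
Qed.

Lemma intertwiners_killing_mono U U' : (U <= U')%MS ->
  (intertwiners_killing U' <= intertwiners_killing U)%VS.
Proof.
move=> UU'; apply/subvP => phi /intertwiners_killingP[H K].
apply/intertwiners_killingP; split=> //.
exact: submx_mul_eq0 K.
Qed.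

Section Step.
Variables U0 U1 : 'M[F]_d.
Hypotheses (U0M : invariant A M U0) (U1M : invariant A M U1) (U01 : (U0 < U1)%MS).
Hypothesis U01min : forall Y : 'M[F]_d, invariant A M Y -> (U0 <= Y)%MS -> (Y <= U1)%MS ->
  (Y == U0)%MS \/ (Y == U1)%MS.

(* A homomorphism that kills [U0] but not [U1] induces an isomorphism of [U1/U0] with [W];
   the factor map is obtained by inverting it. *)
Lemma factor_section phi :
  phi \in intertwiners_killing U0 -> phi \notin intertwiners_killing U1 ->
  exists P : 'M[F]_(w, d), [/\ P *m phi = 1%:M, ((U0 + P)%MS == U1)%MS &
        forall x, x \in A -> (W x *m P - P *m M x <= U0)%MS].
Proof.
move=> /intertwiners_killingP[Hphi U0phi] nphi.
have U1phi : U1 *m phi != 0.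
  by apply: contra nphi => /eqP ?; apply/intertwiners_killingP.
have U01s := ltmxW U01.
have ker_inv : invariant A M (U1 :&: kermx phi)%MS.
  move=> x xA; rewrite sub_capmx; apply/andP; split.
    by apply: submx_trans (U1M xA); rewrite submxMr ?capmxSl.
  by apply/sub_kermxP; rewrite -mulmxA Hphi // mulmxA (sub_kermxP (capmxSr _ _)) mul0mx.
(* By minimality the kernel of [phi] on [U1] is [U0] or [U1], and [U1phi] excludes the latter. *)
have kerU0 : (U1 :&: kermx phi <= U0)%MS.
  case: (U01min ker_inv) => [||/andP[]//|/andP[_]].
  - by rewrite sub_capmx U01s; apply/sub_kermxP.
  - exact: capmxSl.
  rewrite sub_capmx => /andP[_ /sub_kermxP K].
  by rewrite K eqxx in U1phi.
(* The image is a nonzero submodule of the simple module [W]. *)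
have img_full : row_full (U1 *m phi).
  have [_ Ws] := Wsimple.
  have im_inv : invariant A W <<U1 *m phi>>%MS.
    move=> x xA; rewrite !genmxE (eqmxMr _ (genmxE _)) -mulmxA -Hphi // mulmxA.
    by apply: submxMr; apply: U1M.
  case: (Ws _ im_inv) => [|/eqP]; last first.
    by rewrite genmxE => ?; apply/eqP.
  by rewrite andbC sub0mx /= genmxE submx0 (negPf U1phi).
have /submxP[P0 P0E] : (1%:M <= U1 *m phi)%MS by rewrite sub1mx.
exists (P0 *m U1); rewrite -mulmxA -P0E; split=> //.
  rewrite addsmx_sub U01s submxMl /=.
  (* Subtracting from a vector of [U1] its image under [phi *m (P0 *m U1)] leaves an element of the
     kernel of [phi], hence of [U0]. *)
  have U1E : U1 = U1 *m (1%:M - phi *m (P0 *m U1)) + U1 *m phi *m P0 *m U1.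
    by rewrite mulmxBr mulmx1 !mulmxA subrK.
  rewrite [X in (X <= _)%MS]U1E; apply: addmx_sub; last first.
    by apply: submx_trans (addsmxSr _ _); rewrite -(mulmxA _ P0) submxMl.
  apply: submx_trans (addsmxSl _ _); apply: submx_trans kerU0.
  rewrite sub_capmx; apply/andP; split.
    by rewrite mulmxBr mulmx1 addmx_sub // eqmx_opp !mulmxA submxMl.
  apply/sub_kermxP; rewrite -mulmxA mulmxBl mul1mx -!mulmxA -P0E mulmx1.
  by rewrite subrr mulmx0.
move=> x xA; apply: submx_trans kerU0; rewrite sub_capmx; apply/andP; split.
  rewrite addmx_sub ?mulmxA ?submxMl // eqmx_opp -mulmxA.
  by apply: mulmx_sub; apply: U1M.
apply/sub_kermxP; rewrite mulmxBl -!mulmxA Hphi // (mulmxA U1 phi) (mulmxA P0 _ (W x)).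
by rewrite -P0E mulmx1 mul1mx subrr.
Qed.

(** With [P *m phi = 1%:M], the map [phi] is injective on the rows of [P] and kills [U0], so the two
    meet trivially. *)
Lemma factor_iso_of_intertwiner phi :
  phi \in intertwiners_killing U0 -> phi \notin intertwiners_killing U1 ->
  factor_iso A W M U0 U1.
Proof.
move=> phi0 phi1; have [P [Pphi PU PM]] := factor_section phi0 phi1.
have [_ U0phi] := intertwiners_killingP _ _ phi0.
exists P; split=> //; first by apply/row_freeP; exists phi.
rewrite andbC sub0mx /= submx0; set D := (P :&: U0)%MS.
have /submxP[Y DY] : (D <= P)%MS by apply: capmxSl.
have /eqP : D *m phi = 0 by apply: submx_mul_eq0 U0phi; apply: capmxSr.
by rewrite DY -mulmxA Pphi mulmx1 => /eqP ->; rewrite mul0mx.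
Qed.

(* The embedding [W -> U1/U0] lifts to [M] along the complement of [U0] given by Maschke,
   and a left inverse of the lift can be averaged. *)
Lemma intertwiner_of_factor_iso : factor_iso A W M U0 U1 ->
  exists2 phi, phi \in intertwiners_killing U0 & phi \notin intertwiners_killing U1.
Proof.
move=> [P [Pfree PU PU0 PM]].
have [p [/intertwinesP pM pU0 U0p]] := maschke opA cardA Mrep U0M.
pose P' := P *m (1%:M - p).
have P'M x : x \in A -> P' *m M x = W x *m P'.
  (* The failure of [P] to be equivariant lies in [U0], which [1%:M - p] annihilates. *)
  move=> xA; have := PM x xA => /submxP[Y YE].
  apply/eqP; rewrite eq_sym -subr_eq0 /P' -mulmxA mulmxBl mul1mx -pM //.
  rewrite -{1}[M x]mulmx1 -mulmxBr !mulmxA -mulmxBl YE -mulmxA mulmxBr mulmx1.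
  by rewrite U0p subrr mulmx0.
have P'free : row_free P'.
  rewrite -kermx_eq0 -submx0; apply/rV_subP => v /sub_kermxP.
  rewrite /P' mulmxA mulmxBr mulmx1 => /eqP; rewrite subr_eq0 => /eqP vP.
  have : (v *m P <= P :&: U0)%MS.
    by rewrite sub_capmx submxMl vP mulmx_sub.
  move=> /submx_trans/(_ (andP PU0).1); rewrite !submx0.
  by rewrite mulmx_free_eq0.
have /row_freeP[Q P'Q] := P'free.
(* The factor [1%:M - p] makes the inverse of [P'] kill [U0], and averaging preserves this. *)
pose Q1 := (1%:M - p) *m Q.
have pp : p *m p = p by have /submxP[Y pY] := pU0; rewrite {1}pY -mulmxA U0p -pY.
have P'Q1 : P' *m Q1 = 1%:M.
  rewrite -P'Q mulmxA; congr (_ *m _).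
  by rewrite /P' -mulmxA [in X in _ *m X]mulmxBr mulmx1 mulmxBl mul1mx pp subrr subr0.
have U0Q1 : U0 *m Q1 = 0 by rewrite /Q1 mulmxA mulmxBr mulmx1 U0p subrr mul0mx.
have [w0 _] := Wsimple.
exists (average A M W Q1).
  apply/intertwiners_killingP; split; first by apply/intertwinesP; apply: (average_intertwines opA).
  apply: average_fix => // x xA; have /submxP[Y ->] := U0M xA.
  by rewrite -(mulmxA Y) U0Q1 mulmx0 mul0mx.
apply/negP => /intertwiners_killingP[_ K].
have P'avg : P' *m average A M W Q1 = 1%:M.
  apply: average_fix => // x xA; rewrite P'M // -(mulmxA (W x)) P'Q1 mulmx1.
  by rewrite mulmxV //; apply: Wrep.2.
(* An average killing [U1] would also kill [P'], contradicting [P'avg] since [w] is positive. *)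
have : (P' <= U1)%MS.
  have /andP[PU1 _] := PU; apply: submx_trans PU1; rewrite /P' mulmxBr mulmx1.
  rewrite addmx_sub ?addsmxSr // eqmx_opp.
  by apply: submx_trans (addsmxSl _ _); apply: mulmx_sub.
case/submxP => Y P'E; move: P'avg; rewrite P'E -mulmxA K mulmx0 => /matrixP.
move/(_ (Ordinal w0) (Ordinal w0))/eqP; rewrite !mxE eqxx eq_sym.
by rewrite oner_eq0.
Qed.

(** For any [psi] killing [U0], the product [P *m psi] is an endomorphism of [W], hence a scalar
    [a]; then [psi - a *: phi] kills both [U0] and [P], so it kills [U1]. *)
Lemma intertwiners_killing_dim_step phi :
  phi \in intertwiners_killing U0 -> phi \notin intertwiners_killing U1 ->
  \dim (intertwiners_killing U0) = (\dim (intertwiners_killing U1)).+1.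
Proof.
move=> phi0 phi1; have [P [Pphi PU PM]] := factor_section phi0 phi1.
have [Hphi U0phi] := intertwiners_killingP _ _ phi0.
have -> : intertwiners_killing U0 = (intertwiners_killing U1 + <[phi]>)%VS.
  apply/eqP; rewrite eqEsubv; apply/andP; split; last first.
    rewrite subv_add intertwiners_killing_mono -?memvE ?phi0 //.
    exact: ltmxW.
  apply/subvP => psi /intertwiners_killingP[Hpsi U0psi].
  have [|a Pa] := @Wend (P *m psi).
    apply/intertwinesP => x xA; rewrite -mulmxA -Hpsi // !mulmxA.
    apply/eqP; rewrite -subr_eq0 -mulmxBl; apply/eqP.
    by apply: submx_mul_eq0 U0psi; apply: PM.
  rewrite -[psi](subrK (a *: phi)); apply: memv_add; last by rewrite memvZ ?memv_line.
  apply/intertwiners_killingP; split=> [x xA|].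
    by rewrite mulmxBr mulmxBl -scalemxAr -scalemxAl Hpsi ?Hphi.
  have /andP[_ U1s] := PU; apply: submx_mul_eq0 U1s _.
  apply: (submx0null (m2 := w)); rewrite addsmxMr addsmx_sub !mulmxBr -!scalemxAr U0psi U0phi.
  by rewrite Pa Pphi scaler0 scalemx1 !subrr !sub0mx.
have disj : (intertwiners_killing U1 :&: <[phi]> = 0)%VS.
  apply/eqP; rewrite -subv0; apply/subvP => psi.
  rewrite memv_cap memv0 => /andP[psi1 /vlineP[a E]].
  have [a0|a0] := eqVneq a 0; first by rewrite E a0 scale0r.
  by case/negP: phi1; rewrite -[phi](scalerK a0) -E memvZ.
have phi_neq0 : phi != 0 by apply: contraNneq phi1 => ->; rewrite mem0v.
by rewrite dimv_disjoint_sum // dim_vline phi_neq0 addn1.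
Qed.

End Step.

(** The spaces Hom(M/U i, W) decrease from Hom(M, W) to 0, and their dimensions telescope. *)
Theorem multiplicity_is_dim_intertwiners : multiplicity_is A W M (\dim intertwiners).
Proof.
split=> [|l U [U0 Ul UM Ustep]]; first exact: comp_series_exists.
pose K i := intertwiners_killing (U i).
have K0 : K 0%N = intertwiners.
  apply/vspaceP => phi; rewrite memv_cap; case: (phi \in _) => //=.
  by rewrite memv_ker lfunE /=; have /andP[/submx0null-> _] := U0; rewrite mul0mx eqxx.
have Kl : K l = 0%VS.
  apply/eqP; rewrite -subv0; apply/subvP => phi /intertwiners_killingP[_ H].
  have /row_fullP[Y YU] := Ul.
  by rewrite memv0 -[phi]mul1mx -YU -mulmxA H mulmx0.
(* The indices at which the decreasing chain [K] drops strictly. *)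
exists [set i : 'I_l | ~~ (K i <= K i.+1)%VS]; split; last first.
  move=> i; rewrite inE.
  have [Ui Umin] := Ustep i (ltn_ord i).
  have Mi := UM _ (ltnW (ltn_ord i)); have Mi1 := UM _ (ltn_ord i).
  split=> [/subvPn[phi] | /(intertwiner_of_factor_iso Mi)[phi ? ?]].
    exact: factor_iso_of_intertwiner.
  by apply/subvPn; exists phi.
have drop i : (i < l)%N -> \dim (K i) = (~~ (K i <= K i.+1)%VS + \dim (K i.+1))%N.
  move=> il; have [Ui Umin] := Ustep i il.
  have [sK|/subvPn[phi p0 p1]] := boolP (K i <= K i.+1)%VS.
    have -> // : K i = K i.+1.
    apply/eqP; rewrite eqEsubv sK; apply: intertwiners_killing_mono.
    exact: ltmxW.
  by rewrite add1n; apply: intertwiners_killing_dim_step p0 p1; auto; apply: UM => //; apply: ltnW.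
suff: forall j, (j <= l)%N ->
  \dim (K 0%N) = (\sum_(i < j) ~~ (K i <= K i.+1)%VS + \dim (K j))%N.
  move/(_ l (leqnn l)); rewrite K0 Kl dimv0 addn0 => ->.
  by rewrite -sum1dep_card big_mkcond; apply: eq_bigr => i _; case: ifP.
elim=> [|j IH] jl; first by rewrite big_ord0.
by rewrite big_ord_recr /= -addnA -drop // IH // ltnW.
Qed.

End Multiplicity.

(** * Tensor products and the two bimodules [kIrr] and [tens_dual] *)

Lemma tensmx_1scalar (R : comNzRingType) m n (a : R) :
  (1%:M : 'M_m) *t (a%:M : 'M_n) = a%:M.
Proof.
apply/matrixP => p q; case: (mxtens_indexP p) => i j; case: (mxtens_indexP q) => k l.
rewrite tensmxE !mxE (inj_eq (can_inj (@mxtens_indexK m n))) xpair_eqE.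
by rewrite mulr_natl -mulrnA mulnb andbC.
Qed.

Lemma sum_mxtens_index (V : nmodType) m n (f : 'I_(m * n) -> V) :
  \sum_p f p = \sum_i \sum_j f (mxtens_index (i, j)).
Proof.
rewrite pair_bigA /= (reindex (@mxtens_index m n)) /=; last first.
  exists (@mxtens_unindex m n) => ? _; [exact: mxtens_indexK | exact: mxtens_unindexK].
by apply: eq_bigr => -[].
Qed.

Section Bimodules.
Variables (C : fincat) (F : fieldType).
Hypotheses (catC : is_category C) (EIC : is_EI C) (skelC : is_skeletal C).
Implicit Types (c : ob C) (f g h a : arr C).

(* Reversed composition, because the row-vector convention makes [sigma f *m sigma g]
   the action of [g \o f]. *)
Definition rcomp (f g : arr C) : arr C := comp g f.
Definition rcomp2 (x y : arr C * arr C) : arr C * arr C :=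
  (comp y.1 x.1, comp y.2 x.2).

Lemma endo_translations c : translations_permute (endo c) rcomp.
Proof.
split=> [f g fc gc|f fc g h]; first exact: comp_endo.
by move=> /endoP[sg _] /endoP[sh _]; apply: (comp_endo_injr catC EIC fc).
Qed.

Lemma setX_translations c c' :
  translations_permute (setX (endo c') (endo c)) rcomp2.
Proof.
have [[cl inj] [cl' inj']] := (endo_translations c, endo_translations c').
split=> [[g h] [g' h'] | [g h] + [g1 h1] [g2 h2]].
  by rewrite !in_setX /= => /andP[gA hA] /andP[gA' hA']; rewrite cl ?cl'.
rewrite !in_setX /= => /andP[gA hA] /andP[g1A h1A] /andP[g2A h2A] [E1 E2].
by congr (_, _); [apply: inj' E1 | apply: inj E2].
Qed.

Section GrpRep.
Variables (c : ob C) (n : nat) (sigma : arr C -> 'M[F]_n).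
Hypothesis sigma_rep : grp_rep c sigma.

Lemma grp_repV a : a \in endo c -> sigma a *m sigma (inv a) = 1%:M.
Proof.
case: sigma_rep => s1 sM ac.
by rewrite sM ?(inv_endo EIC) // (comp_inv_l EIC ac).
Qed.

Lemma grp_rep_unitmx a : a \in endo c -> sigma a \in unitmx.
Proof. by move=> /grp_repV/mulmx1_unit[]. Qed.

End GrpRep.

Section Pair.
Variables c c' : ob C.
Local Notation A := (setX (endo c') (endo c)).

Definition act_mor (x : arr C * arr C) f : arr C := comp x.1 (comp f (inv x.2)).

Lemma act_mor_Irr x f : x \in A -> f \in IrrMor c c' -> act_mor x f \in IrrMor c c'.
Proof.
case: x => g h; rewrite in_setX => /andP[gA hA] fI.
by apply: (IrrMor_act catC EIC skelC) => //; apply: (inv_endo EIC).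
Qed.

Lemma act_mor_rcomp2 x y f : x \in A -> y \in A -> f \in IrrMor c c' ->
  act_mor (rcomp2 x y) f = act_mor y (act_mor x f).
Proof.
case: x y => [g h] [g' h']; rewrite !in_setX /= => /andP[gA hA] /andP[gA' hA'] fI.
rewrite /act_mor /= (inv_comp catC EIC hA hA').
have [/endoP[sg tg] /endoP[sg' tg']] := (gA, gA').
have /endoP[sh th] := inv_endo EIC hA.
have /endoP[sh' th'] := inv_endo EIC hA'.
have sf := IrrMor_src catC EIC skelC fI; have tf := IrrMor_tgt catC EIC skelC fI.
by rewrite !(compA catC, src_comp catC, tgt_comp catC) ?(src_comp catC, tgt_comp catC)
  ?sg ?tg ?sg' ?tg' ?sh ?th ?sh' ?th' ?sf ?tf.
Qed.

(** [kIrr] acts by permutation matrices, so a product with it only moves rows; later computations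
    are done row by row. *)
Lemma kIrrE x i p (N : 'M[F]_(_, p)) j : x \in A ->
  enum_val j = act_mor x (enum_val i) -> row i (kIrr F c c' x *m N) = row j N.
Proof.
move=> xA Ej; rewrite row_mul -[in RHS](mul1mx N) [in RHS]row_mul; congr (_ *m _).
apply/rowP => k; rewrite !mxE -/(act_mor x (enum_val i)) -Ej.
by rewrite (inj_eq enum_val_inj) eq_sym.
Qed.

Lemma act_index x (i : 'I_#|IrrMor c c'|) : x \in A ->
  exists j : 'I_#|IrrMor c c'|, enum_val j = act_mor x (enum_val i).
Proof.
move=> xA; have iI := enum_valP i; have I2 := act_mor_Irr xA iI.
by exists (enum_rank_in iI (act_mor x (enum_val i))); rewrite enum_rankK_in.
Qed.

Lemma kIrr_mul x y : x \in A -> y \in A ->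
  kIrr F c c' x *m kIrr F c c' y = kIrr F c c' (rcomp2 x y).
Proof.
move=> xA yA; apply/row_matrixP => i; have [j Ej] := act_index i xA.
rewrite (kIrrE _ xA Ej); apply/rowP => k; rewrite !mxE.
rewrite -/(act_mor y (enum_val j)) -/(act_mor (rcomp2 x y) (enum_val i)).
by rewrite act_mor_rcomp2 ?enum_valP // Ej.
Qed.

Lemma kIrr_id : kIrr F c c' (idm c', idm c) = 1%:M.
Proof.
have idE f : src f = c -> tgt f = c' -> comp (idm c') (comp f (idm c)) = f.
  by move=> <- <-; rewrite comp_idr // comp_idl.
apply/matrixP => i j; rewrite !mxE /= (inv_idm catC EIC).
have /(IrrMorP catC EIC skelC)[sf tf _ _] := enum_valP i; rewrite idE //.
by rewrite (inj_eq enum_val_inj) eq_sym.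
Qed.

Definition inv2 (x : arr C * arr C) := (inv x.1, inv x.2).

Lemma inv2_mem x : x \in A -> inv2 x \in A.
Proof.
by case: x => g h; rewrite !in_setX /= => /andP[? ?]; rewrite !(inv_endo EIC).
Qed.

Lemma rcomp2_inv2 x : x \in A -> rcomp2 x (inv2 x) = (idm c', idm c).
Proof.
case: x => g h; rewrite in_setX /rcomp2 /inv2 /= => /andP[x1 x2].
by rewrite (comp_inv_l EIC x1) (comp_inv_l EIC x2).
Qed.

Lemma mat_rep_of_id d (M : arr C * arr C -> 'M[F]_d) :
  M (idm c', idm c) = 1%:M ->
  {in A &, forall x y, M x *m M y = M (rcomp2 x y)} -> mat_rep A rcomp2 M.
Proof.
move=> M1 MM; split=> // x xA.
by have /mulmx1_unit[] : M x *m M (inv2 x) = 1%:M by rewrite MM ?inv2_mem // rcomp2_inv2.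
Qed.

Lemma kIrr_mat_rep : mat_rep A rcomp2 (kIrr F c c').
Proof. by apply: mat_rep_of_id kIrr_id _ => x y; apply: kIrr_mul. Qed.

Variables (n m : nat) (sigmaU : arr C -> 'M[F]_n) (sigmaV : arr C -> 'M[F]_m).
Hypotheses (Urep : grp_rep c sigmaU) (Vrep : grp_rep c' sigmaV).

(** On the factor from [U], transposition and [inv] each reverse the order of products, so together
    they preserve it. *)
Lemma tens_dual_mat_rep : mat_rep A rcomp2 (tens_dual sigmaU sigmaV).
Proof.
have [[U1 UM] [V1 VM]] := (Urep, Vrep).
apply: mat_rep_of_id.
  by rewrite /tens_dual /= (inv_idm catC EIC) U1 V1 trmx1 tensmx_1scalar.
move=> [g h] [g' h']; rewrite !in_setX /= => /andP[gA hA] /andP[gA' hA'].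
rewrite /tens_dual /= tensmx_mul VM // -trmx_mul UM ?(inv_endo EIC) //.
by rewrite (inv_comp catC EIC hA hA').
Qed.

Hypotheses (Usimple : simple_on (endo c) sigmaU) (Vsimple : simple_on (endo c') sigmaV).
Hypothesis Uend : forall B : 'M[F]_n,
  (forall g, g \in endo c -> sigmaU g *m B = B *m sigmaU g) -> exists a : F, B = a%:M.
Hypothesis Vend : forall B : 'M[F]_m,
  (forall g, g \in endo c' -> sigmaV g *m B = B *m sigmaV g) -> exists a : F, B = a%:M.

(* Commuting with [V] forces [T = 1 (x) t], and then commuting with [U^*] forces [t] scalar. *)
Lemma tens_dual_end T : intertwines A (tens_dual sigmaU sigmaV) (tens_dual sigmaU sigmaV) T ->
  exists a : F, T = a%:M.
Proof.
move=> /intertwinesP TM; have [[U1 UM] [V1 VM]] := (Urep, Vrep).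
have [[n0 _] [m0 _]] := (Usimple, Vsimple).
(* Blocks of [T] for fixed indices on the [U] side; the pairs [(g, idm c)] show that each commutes
   with [sigmaV]. *)
pose blk j l : 'M[F]_m := \matrix_(i, k) T (mxtens_index (i, j)) (mxtens_index (k, l)).
have blk_scal j l : exists a : F, blk j l = a%:M.
  apply: Vend => g gA; apply/matrixP => i k.
  have := TM (g, idm c); rewrite in_setX gA (idm_endo catC) => /(_ isT).
  move/matrixP/(_ (mxtens_index (i, j)) (mxtens_index (k, l))).
  rewrite !mxE !sum_mxtens_index /tens_dual /= (inv_idm catC EIC) U1 trmx1.
  have -> : \sum_i0 \sum_j0
       (sigmaV g *t 1%:M) (mxtens_index (i, j)) (mxtens_index (i0, j0)) *
       T (mxtens_index (i0, j0)) (mxtens_index (k, l)) = \sum_i0 sigmaV g i i0 * blk j l i0 k.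
    apply: eq_bigr => i0 _; rewrite (bigD1 j) //= big1 ?addr0 => [|j0 jj].
      by rewrite tensmxE !mxE eqxx mulr1.
    by rewrite tensmxE !mxE eq_sym (negPf jj) mulr0 mul0r.
  move=> ->; apply: eq_bigr => i0 _; rewrite (bigD1 l) //= big1 ?addr0 => [|j0 jj].
    by rewrite tensmxE !mxE eqxx mulr1.
  by rewrite tensmxE !mxE (negPf jj) !mulr0.
pose i0 := Ordinal m0; pose j0 := Ordinal n0.
pose t : 'M[F]_n := \matrix_(j, l) blk j l i0 i0.
have TE : T = 1%:M *t t.
  apply/matrixP => p q; case: (mxtens_indexP p) => i j; case: (mxtens_indexP q) => k l.
  rewrite tensmxE !mxE; have [a blkE] := blk_scal j l.
  have /matrixP/(_ i k) := blkE; rewrite !mxE => ->.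
  have /matrixP/(_ i0 i0) := blkE; rewrite !mxE => ->.
  by rewrite eqxx mulr1n mulr_natl.
(* [tens_dual] contains the transpose of [sigmaU (inv h)], so [Uend] applies to [t^T], and the
   equation at [h] comes from the pair [(idm c', inv h)]. *)
have [|a ta] := Uend (B := t^T).
  move=> h hA; have := TM (idm c', inv h).
  rewrite in_setX (idm_endo catC) (inv_endo EIC hA) => /(_ isT).
  rewrite /tens_dual /= (inv_inv catC EIC hA) V1 TE !tensmx_mul !mul1mx => E.
  apply: trmx_inj; rewrite !trmx_mul trmxK; apply/esym.
  apply/matrixP => j l; have /matrixP/(_ (mxtens_index (i0, j)) (mxtens_index (i0, l))) := E.
  by rewrite !tensmxE !mxE eqxx !mul1r.
exists a; rewrite TE -[t]trmxK ta tr_scalar_mx.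
exact: tensmx_1scalar.
Qed.

End Pair.
End Bimodules.

(** * Cocycles and coboundaries as vector spaces *)

Section Cocycles.
Variables (C : fincat) (F : fieldType) (n m : nat).
Variables (rho : arr C -> 'M[F]_n) (tau : arr C -> 'M[F]_m).
Implicit Types (delta : {ffun arr C -> 'M[F]_(n, m)}).

(** [cocycles] is defined through [linfun], which evaluates to the given function once linearity is
    known. *)
Fact cocycle_defect_linear : linear (cocycle_defect rho tau).
Proof.
move=> a u v; apply: injective_projections => /=.
  have gen (x y p q s t : 'M[F]_(n, m)) :
      a *: x + y - (a *: p + q + (a *: s + t)) = a *: (x - (p + s)) + (y - (q + t)).
    by rewrite [a *: p + q + _]addrACA -scalerDr opprD addrACA -scalerBr.
  apply/ffunP => -[f g]; rewrite !ffunE /= mulmxDl mulmxDr -scalemxAl -scalemxAr -gen.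
  by case: ifP => _; rewrite ?ffunE // scaler0 addr0.
rewrite scaler_sumr -big_split; apply: eq_bigr => c _.
by rewrite !ffunE.
Qed.
HB.instance Definition _ := GRing.isLinear.Build F _ _ _
  (cocycle_defect rho tau) cocycle_defect_linear.

Fact coboundary_linear : linear (coboundary rho tau).
Proof.
move=> a u v; apply/ffunP => p; rewrite !ffunE mulmxDl mulmxDr -scalemxAl -scalemxAr.
by rewrite opprD addrACA scalerBr.
Qed.
HB.instance Definition _ := GRing.isLinear.Build F _ _ _
  (coboundary rho tau) coboundary_linear.

Lemma cocyclesP delta : delta \in cocycles rho tau <->
  (forall f g, delta f *m tau g + rho f *m delta g =
               if tgt f == src g then delta (comp g f) else 0) /\
  \sum_(c : ob C) delta (idm c) = 0.
Proof.
rewrite memv_ker lfunE /= /cocycle_defect xpair_eqE; split.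
  move=> /andP[/eqP/ffunP H /eqP S]; split=> // f g.
  by have := H (f, g); rewrite !ffunE /= => /eqP; rewrite subr_eq0 => /eqP.
case=> H ->; rewrite eqxx andbT; apply/eqP/ffunP => -[f g].
by rewrite !ffunE /= H subrr.
Qed.

Lemma coboundariesP delta :
  reflect (exists B, delta = coboundary rho tau B) (delta \in coboundaries rho tau).
Proof.
apply: (iffP memv_imgP) => [[B _ ->] | [B ->]]; exists B; rewrite ?lfunE ?memvf //.
Qed.

Lemma coboundaries_cocycles : cat_rep rho -> cat_rep tau ->
  (coboundaries rho tau <= cocycles rho tau)%VS.
Proof.
move=> [rM r1] [tM t1]; apply/subvP => _ /coboundariesP[B ->].
apply/cocyclesP; split=> [f g|].
  rewrite !ffunE mulmxBl mulmxBr -!(mulmxA B) tM !mulmxA rM addrC subrKA.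
  by case: ifP; rewrite ?mul0mx ?mulmx0 ?subrr.
under eq_bigr do rewrite ffunE.
by rewrite sumrB -mulmx_suml -mulmx_sumr r1 t1 mul1mx mulmx1 subrr.
Qed.

End Cocycles.

(** * Inflated representations and the classification of simple modules *)

Section Inflation.
Variables (C : fincat) (F : fieldType).
Hypotheses (catC : is_category C) (EIC : is_EI C) (skelC : is_skeletal C).
Implicit Types (c x : ob C) (f g h a : arr C).

(** The composite [g f] is an automorphism, so [f] has the left inverse given by [g] followed by the
    inverse of [g f]. *)
Lemma no_loops f g : tgt f = src g -> tgt g = src f -> src f = tgt f.
Proof.
move=> fg gf; apply: (split_mono_src_tgt catC EIC skelC); apply/existsP.
have ac : comp g f \in endo (src f) by apply/endoP; rewrite src_comp ?tgt_comp.
have /endoP[si ti] := inv_endo EIC ac.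
exists (comp (inv (comp g f)) g); rewrite src_comp ?tgt_comp ?gf ?si ?ti // fg.
by rewrite -compA ?gf ?si // (comp_inv_l EIC ac) !eqxx.
Qed.

(** A path that leaves [c] cannot return to it; this is what makes extension by zero multiplicative
    in [infl]. *)
Lemma comp_endoE c f g : tgt f = src g ->
  (comp g f \in endo c) = (f \in endo c) && (g \in endo c).
Proof.
move=> fg; apply/idP/andP => [|[fc gc]]; last exact: comp_endo.
move=> /endoP[]; rewrite src_comp ?tgt_comp // => sf tg.
have sft := no_loops fg (etrans tg (esym sf)).
by split; apply/endoP; rewrite ?tg -?fg -?sft.
Qed.

Lemma inflE c n (sigma : arr C -> 'M[F]_n) a :
  infl c sigma a = if a \in endo c then sigma a else 0.
Proof. by rewrite /infl inE. Qed.

Lemma infl_idm c n (sigma : arr C -> 'M[F]_n) x : grp_rep c sigma ->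
  infl c sigma (idm x) = if x == c then 1%:M else 0.
Proof.
move=> [s1 _]; rewrite /infl src_idm // tgt_idm // andbb.
by case: eqP => // ->.
Qed.

Lemma infl_cat_rep c n (sigma : arr C -> 'M[F]_n) : grp_rep c sigma -> cat_rep (infl c sigma).
Proof.
move=> srep; have [s1 sM] := srep; split=> [f g|].
  rewrite !inflE; have [fg|fg] := eqVneq.
    rewrite comp_endoE //.
    by have [fc|] := boolP (f \in _); have [gc|] := boolP (g \in _);
       rewrite ?mul0mx ?mulmx0 // sM.
  have [/endoP[_ fc]|] := boolP (f \in _); last by rewrite mul0mx.
  have [/endoP[gc _]|] := boolP (g \in _); last by rewrite mulmx0.
  by rewrite fc gc eqxx in fg.
rewrite (bigD1 c) //= infl_idm // eqxx big1 ?addr0 // => x xc.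
by rewrite infl_idm // (negPf xc).
Qed.

Lemma infl_simple c n (sigma : arr C -> 'M[F]_n) :
  simple_on (endo c) sigma -> simple_on [set: arr C] (infl c sigma).
Proof.
move=> [n0 s]; split=> // U UM; apply: s => a ac.
by have := UM a (in_setT _); rewrite inflE ac.
Qed.

(* The object [c] is chosen as far along the arrows as possible within the support of
   [rho], which makes the row space of [rho (idm c)] a submodule. *)
Lemma simple_infl n (rho : arr C -> 'M[F]_n) :
  cat_rep rho -> simple_on [set: arr C] rho ->
  exists (c : ob C) (sigma : arr C -> 'M[F]_n),
    [/\ grp_rep c sigma, simple_on (endo c) sigma &
        iso_on [set: arr C] rho (infl c sigma)].
Proof.
move=> [rM r1] [n0 rsimple].
have [c0 rc0] : exists c, rho (idm c) != 0.
  apply/existsP; apply: contraT; rewrite negb_exists => /forallP r0.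
  have : 1%:M = 0 :> 'M[F]_n.
    by rewrite -r1 big1 // => c _; apply/eqP; have := r0 c; rewrite negbK.
  move/matrixP/(_ (Ordinal n0) (Ordinal n0))/eqP.
  by rewrite !mxE eqxx oner_eq0.
(* [up x] collects the objects reachable from [x]; a last object of the support is one that
   minimises its size. *)
pose up x := [set y | [exists a : arr C, (src a == x) && (tgt a == y)]].
case: (@arg_minnP _ c0 (fun x => rho (idm x) != 0) (fun x => #|up x|) rc0) => c rc cmin.
have rho_src a : rho (idm (src a)) *m rho a = rho a.
  by rewrite rM tgt_idm // eqxx comp_idr.
have rho_tgt a : rho a *m rho (idm (tgt a)) = rho a.
  by rewrite rM src_idm // eqxx comp_idl.
have leave a : src a = c -> tgt a != c -> rho a = 0.
  move=> sa ta; rewrite -rho_tgt.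
  have [->|nz] := eqVneq (rho (idm (tgt a))) 0; first by rewrite mulmx0.
  (* Everything reachable from [tgt a] is reachable from [c], but [c] itself is not, by [no_loops];
     so the minimum would be beaten. *)
  have := cmin _ nz; rewrite leqNgt proper_card //; apply/properP; split.
    apply/subsetP => y; rewrite !inE => /existsP[b /andP[/eqP sb /eqP tb]].
    by apply/existsP; exists (comp b a); rewrite src_comp ?tgt_comp ?sa ?tb ?eqxx.
  exists c; rewrite inE.
    by apply/existsP; exists (idm c); rewrite src_idm ?tgt_idm ?eqxx.
  apply/negP => /existsP[b /andP[/eqP sb /eqP tb]].
  by move: ta; rewrite -(no_loops (f := a) (g := b)) ?sa ?eqxx.
(* Since arrows leaving [c] act by zero, the image of this nonzero idempotent is a submodule, hence
   everything. *)
have e1 : rho (idm c) = 1%:M.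
  have idem : rho (idm c) *m rho (idm c) = rho (idm c).
    by have := rho_src (idm c); rewrite src_idm.
  case: (rsimple (rho (idm c))) => [a _| /andP[] | /row_fullP[Y YE]].
  - rewrite rM tgt_idm //; case: eqP => [sa|_]; last exact: sub0mx.
    have [ta|ta] := eqVneq (tgt a) c; last by rewrite sa comp_idr // leave ?sub0mx.
    by rewrite {1}sa comp_idr // -[rho a]rho_tgt ta submxMl.
  - by rewrite submx0 (negPf rc).
  by rewrite -[LHS]mul1mx -YE -mulmxA idem.
have e0 x : x != c -> rho (idm x) = 0.
  move=> xc; rewrite -[LHS]mul1mx -e1 rM src_idm // tgt_idm //.
  by rewrite eq_sym (negPf xc).
have rho0 a : a \notin endo c -> rho a = 0.
  rewrite inE negb_and => /orP[] /e0 z; first by rewrite -rho_src z mul0mx.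
  by rewrite -rho_tgt z mulmx0.
exists c, rho; split.
- split=> // f g /endoP[_ tf] /endoP[sg _].
  by rewrite rM tf sg eqxx.
- split=> // U UM; apply: rsimple => a _.
  by have [/UM//|/rho0->] := boolP (a \in endo c); rewrite mulmx0 sub0mx.
exists 1%:M; split; rewrite ?row_free_unit ?row_full_unit ?unitmx1 // => a _.
by rewrite mulmx1 mul1mx inflE; case: ifPn => // /rho0.
Qed.

(** For distinct objects, [idm c] acts as 1 on the first module and as 0 on the second, forcing
    [P = 0] in positive dimension. *)
Lemma infl_iso c c' n n' (sigma : arr C -> 'M[F]_n) (sigma' : arr C -> 'M[F]_n') :
  (0 < n)%N -> grp_rep c sigma -> grp_rep c' sigma' ->
  (iso_on [set: arr C] (infl c sigma) (infl c' sigma') <->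
   c = c' /\ iso_on (endo c) sigma sigma').
Proof.
move=> n0 srep srep'; split=> [[P [Pfree Pfull PM]] | [<- [P [Pfree Pfull PM]]]].
  have [cc|cc] := eqVneq c c'; last first.
    have := PM (idm c) (in_setT _).
    rewrite !infl_idm // eqxx (negPf cc) mul1mx mulmx0 => P0.
    by move: Pfree; rewrite /row_free P0 mxrank0 eq_sym -leqn0 leqNgt n0.
  split=> //; exists P; split=> // a ac; have := PM a (in_setT _).
  by rewrite !inflE -cc ac.
exists P; split=> // a _; rewrite !inflE.
by case: ifP => [/PM//|_]; rewrite mul0mx mulmx0.
Qed.

End Inflation.

(** * Computation of Ext^1 between inflated modules *)

Section Extensions.
Variables (C : fincat) (F : fieldType).
Hypotheses (catC : is_category C) (EIC : is_EI C) (skelC : is_skeletal C).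
Variables (c c' : ob C) (n m : nat).
Variables (sigmaU : arr C -> 'M[F]_n) (sigmaV : arr C -> 'M[F]_m).
Hypotheses (Urep : grp_rep c sigmaU) (Vrep : grp_rep c' sigmaV).
Local Notation A := (setX (endo c') (endo c)).
Local Notation rho := (infl c sigmaU).
Local Notation tau := (infl c' sigmaV).
Local Notation Z := (cocycles rho tau).
Local Notation r := #|IrrMor c c'|.
Implicit Types (x : ob C) (f g h a : arr C) (delta : {ffun arr C -> 'M[F]_(n, m)}).

(** Identifies the tensor product of V with the dual of U with Hom(U, V), where cocycles take their
    values. *)
Definition mx_of_tens (v : 'rV[F]_(m * n)) : 'M[F]_(n, m) :=
  \matrix_(l, k) v 0 (mxtens_index (k, l)).
Definition tens_of_mx (D : 'M[F]_(n, m)) : 'rV[F]_(m * n) :=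
  \row_p D (mxtens_unindex p).2 (mxtens_unindex p).1.

Lemma mx_of_tensK : cancel mx_of_tens tens_of_mx.
Proof.
move=> v; apply/rowP => p; rewrite !mxE.
by rewrite -surjective_pairing mxtens_unindexK.
Qed.
Lemma tens_of_mxK : cancel tens_of_mx mx_of_tens.
Proof. by move=> D; apply/matrixP => l k; rewrite !mxE mxtens_indexK. Qed.

Lemma mx_of_tens_mul v (P : 'M[F]_n) (Q : 'M[F]_m) :
  mx_of_tens (v *m (Q *t P^T)) = P *m mx_of_tens v *m Q.
Proof.
apply/matrixP => l k; rewrite !mxE sum_mxtens_index.
apply: eq_bigr => i _; rewrite mxE mulr_suml; apply: eq_bigr => j _.
by rewrite tensmxE !mxE mulrCA [LHS]mulrC [v _ _ * _]mulrC.
Qed.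

Definition restrict_Irr delta : 'M[F]_(r, m * n) :=
  \matrix_(i < r) tens_of_mx (delta (enum_val i)).

Fact restrict_Irr_linear : linear restrict_Irr.
Proof. by move=> a u v; apply/matrixP => i p; rewrite !mxE !ffunE !mxE. Qed.
HB.instance Definition _ := GRing.isLinear.Build F _ _ _
  restrict_Irr restrict_Irr_linear.

Lemma restrict_Irr_eq0 delta : restrict_Irr delta = 0 <->
  forall f, f \in IrrMor c c' -> delta f = 0.
Proof.
split=> [/row_matrixP d0 f fI | d0].
  have := d0 (enum_rank_in fI f); rewrite rowK row0 enum_rankK_in // => E.
  rewrite -[delta f]tens_of_mxK E.
  by apply/matrixP => ? ?; rewrite !mxE.
apply/row_matrixP => i; rewrite rowK row0 d0 ?enum_valP //.
by apply/rowP => ?; rewrite !mxE.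
Qed.

Lemma IrrMor_endo x f : f \in IrrMor c c' -> f \notin endo x.
Proof.
move=> /(IrrMorP catC EIC skelC)[sf tf ne _].
by apply/endoP => -[sx tx]; apply: ne; rewrite -sf -tf sx tx.
Qed.

Lemma infl_Irr x k (sigma : arr C -> 'M[F]_k) f : f \in IrrMor c c' -> infl x sigma f = 0.
Proof. by move=> /(IrrMor_endo x) fx; rewrite inflE (negPf fx). Qed.

(** In the cocycle identity for an irreducible arrow composed with an automorphism, the term
    applying [infl] to the irreducible arrow vanishes; this is used once on each side. *)
Lemma cocycle_act delta y f : delta \in Z -> y \in A -> f \in IrrMor c c' ->
  delta (act_mor y f) = sigmaU (inv y.2) *m delta f *m sigmaV y.1.
Proof.
case: y => g h /cocyclesP[dZ _]; rewrite in_setX /= => /andP[gA hA] fI.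
have hiA := inv_endo EIC hA.
have fhI : comp f (inv h) \in IrrMor c c'.
  by rewrite (IrrMor_compr catC EIC skelC) // (IrrMor_src catC EIC skelC fI).
have /endoP[sg _] := gA; have /endoP[_ th] := hiA.
have := dZ (comp f (inv h)) g; rewrite (IrrMor_tgt catC EIC skelC fhI) sg eqxx => <-.
rewrite (infl_Irr _ _ fhI) mul0mx addr0 inflE gA; congr (_ *m _).
have := dZ (inv h) f; rewrite (IrrMor_src catC EIC skelC fI) th eqxx => <-.
by rewrite (infl_Irr _ _ fI) mulmx0 add0r inflE hiA.
Qed.

Lemma restrict_Irr_intertwines delta : delta \in Z ->
  intertwines A (kIrr F c c') (tens_dual sigmaU sigmaV) (restrict_Irr delta).
Proof.
move=> dZ; apply/intertwinesP => y yA; apply/row_matrixP => i.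
have [j Ej] := act_index catC EIC skelC i yA.
rewrite (kIrrE _ yA Ej) row_mul !rowK Ej cocycle_act ?enum_valP //.
by rewrite -[RHS]mx_of_tensK mx_of_tens_mul tens_of_mxK.
Qed.

(** Extension by zero off the irreducible arrows; at most one summand is nonzero. *)
Definition extend_Irr (Phi : 'M[F]_(r, m * n)) : {ffun arr C -> 'M[F]_(n, m)} :=
  [ffun a => \sum_(i < r) (enum_val i == a)%:R *: mx_of_tens (row i Phi)].

Lemma extend_Irr_val Phi i : extend_Irr Phi (enum_val i) = mx_of_tens (row i Phi).
Proof.
rewrite ffunE (bigD1 i) //= eqxx scale1r big1 ?addr0 // => j ji.
by rewrite (inj_eq enum_val_inj) (negPf ji) scale0r.
Qed.

Lemma extend_Irr0 Phi a : a \notin IrrMor c c' -> extend_Irr Phi a = 0.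
Proof.
move=> aI; rewrite ffunE big1 // => i _; case: eqP => [E|]; last by rewrite scale0r.
by rewrite -E enum_valP in aI.
Qed.

Lemma extend_IrrK : cancel extend_Irr restrict_Irr.
Proof.
by move=> Phi; apply/row_matrixP => i; rewrite rowK extend_Irr_val mx_of_tensK.
Qed.

Section Extend.
Variable Phi : 'M[F]_(r, m * n).
Hypothesis PhiM : intertwines A (kIrr F c c') (tens_dual sigmaU sigmaV) Phi.

Lemma extend_Irr_act y f : y \in A -> f \in IrrMor c c' ->
  extend_Irr Phi (act_mor y f) = sigmaU (inv y.2) *m extend_Irr Phi f *m sigmaV y.1.
Proof.
move=> yA fI; rewrite -(enum_rankK_in fI fI); set i := enum_rank_in _ _.
have [j Ej] := act_index catC EIC skelC i yA.
rewrite -Ej !extend_Irr_val -(kIrrE _ yA Ej) (intertwinesP _ _ _ _ PhiM y yA).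
by rewrite row_mul mx_of_tens_mul.
Qed.

Lemma extend_Irr_cocycle : extend_Irr Phi \in Z.
Proof.
have ext_endo x a : a \in endo x -> extend_Irr Phi a = 0.
  by move=> ax; apply: extend_Irr0; apply: contraL ax => /IrrMor_endo ->.
have [[U1 _] [V1 _]] := (Urep, Vrep).
apply/cocyclesP; split=> [f g|]; last first.
  by rewrite big1 // => x _; apply: ext_endo (idm_endo catC x).
rewrite !inflE.
have [fc|fc] := boolP (f \in endo c).
  have /endoP[_ tf] := fc.
  rewrite (ext_endo c f fc) mul0mx add0r.
  have [gI|gI] := boolP (g \in IrrMor c c'); last first.
    rewrite extend_Irr0 // mulmx0; case: eqP => // fg.
    by rewrite extend_Irr0 // (IrrMor_compr catC EIC skelC) // -fg.
  have sg := IrrMor_src catC EIC skelC gI; have tg := IrrMor_tgt catC EIC skelC gI.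
  have idE : comp (idm c') (comp g f) = comp g f.
    by rewrite -[X in idm X]tg -(tgt_comp catC (f := f) (g := g)) ?comp_idl ?tf.
  (* [act_mor] precomposes with an inverse, hence [inv f]. *)
  have := extend_Irr_act (y := (idm c', inv f)) _ gI.
  rewrite in_setX idm_endo // (inv_endo EIC fc) => /(_ isT).
  rewrite /act_mor /= (inv_inv catC EIC fc) V1 mulmx1 sg tf eqxx => <-.
  by rewrite idE.
rewrite mul0mx addr0; have [gc|gc] := boolP (g \in endo c'); last first.
  (* Here [f] is not an endomorphism of [c] and [g] is not one of [c'], so the composite is not
     irreducible and both sides vanish. *)
  rewrite mulmx0; case: eqP => // fg; rewrite extend_Irr0 //; apply/negP.
  move=> /(IrrMorP catC EIC skelC)[]; rewrite src_comp ?tgt_comp // => sf tg _.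
  case/(_ g f) => // sg.
    by case/endoP: fc; rewrite sf fg sg.
  by case/endoP: gc.
have /endoP[sg _] := gc.
have [fI|fI] := boolP (f \in IrrMor c c'); last first.
  rewrite extend_Irr0 // mul0mx; case: eqP => // fg.
  by rewrite extend_Irr0 // (IrrMor_compl catC EIC skelC) // fg.
have sf := IrrMor_src catC EIC skelC fI; have tf := IrrMor_tgt catC EIC skelC fI.
have idE : comp f (idm c) = f by rewrite -sf comp_idr.
have := extend_Irr_act (y := (g, idm c)) _ fI.
rewrite in_setX gc idm_endo // => /(_ isT).
rewrite /act_mor /= (inv_idm catC EIC) U1 mul1mx tf sg eqxx => <-.
by rewrite idE.
Qed.

End Extend.

Lemma image_restrict_Irr : (linfun restrict_Irr @: Z)%VS =
  intertwiners A (kIrr F c c') (tens_dual sigmaU sigmaV).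
Proof.
apply/vspaceP => Phi; rewrite mem_intertwiners; apply/memv_imgP/idP.
  by case=> delta dZ ->; rewrite lfunE; apply: restrict_Irr_intertwines.
by move=> PhiM; exists (extend_Irr Phi); rewrite ?extend_Irr_cocycle // lfunE /= extend_IrrK.
Qed.

(* A cocycle vanishing on identities is supported on the arrows [c -> c'] and kills composites
   through a third object. *)
Lemma cocycle_eq0 delta : delta \in Z ->
  (forall x, delta (idm x) = 0) -> (forall f, f \in IrrMor c c' -> delta f = 0) ->
  c <> c' -> delta = 0.
Proof.
move=> /cocyclesP[dZ _] d1 dI cc'; apply/ffunP => a; rewrite [RHS]ffunE.
have [->//|da] := eqVneq (delta a) 0; apply: dI.
have sa : src a = c.
  apply: contraNeq da => sa; have := dZ (idm (src a)) a.
  rewrite tgt_idm // eqxx comp_idr // d1 mul0mx add0r infl_idm // (negPf sa) mul0mx.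
  by move<-.
have ta : tgt a = c'.
  apply: contraNeq da => ta; have := dZ a (idm (tgt a)).
  rewrite src_idm // eqxx comp_idl // d1 mulmx0 addr0 infl_idm // (negPf ta) mulmx0.
  by move<-.
apply/(IrrMorP catC EIC skelC); split=> // g h sh th tg gh.
have [->|sgc] := eqVneq (src g) c; [by left | have [->|sgc'] := eqVneq (src g) c'; first by right].
move: da; rewrite -gh; have := dZ h g; rewrite th eqxx => <-.
rewrite /infl tg th (negPf sgc) (negPf sgc') andbF /=.
by rewrite mul0mx mulmx0 addr0 eqxx.
Qed.

Hypothesis card_c : #|endo c|%:R != 0 :> F.

(** Let [S] be the sum of [delta g *m invmx (sigmaV g)] over the group. Reindexing by [f] gives [S
    *m sigmaV f = #|endo c|%:R *: delta f + sigmaU f *m S], so minus the average is a primitive; the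
    sign matches the convention in [coboundary]. *)
Lemma cocycle_coboundary_same delta : c = c' -> delta \in Z -> delta \in coboundaries rho tau.
Proof.
move=> cc' /cocyclesP[dZ _]; move: Vrep dZ; rewrite -cc' => Vrep' dZ.
(* At [c] the cocycle identity reads d = d + d; at any other object both its terms vanish. *)
have d1 x : delta (idm x) = 0.
  have := dZ (idm x) (idm x); rewrite tgt_idm // src_idm // eqxx !infl_idm //.
  rewrite comp_idm //; case: eqP => _; last by rewrite mul0mx mulmx0 addr0 => <-.
  by rewrite mulmx1 mul1mx => /eqP; rewrite -subr_eq0 addrK => /eqP.
have Vu a : a \in endo c -> sigmaV a \in unitmx by apply: (grp_rep_unitmx EIC Vrep').
apply/coboundariesP; exists (- (#|endo c|%:R^-1 *: \sum_(g in endo c) delta g *m invmx (sigmaV g))).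
apply/ffunP => f; rewrite ffunE !inflE; have [fc|fc] := boolP (f \in endo c); last first.
  (* An arrow outside [endo c] has an end other than [c]; composing with the identity there gives
     [delta f = 0]. *)
  rewrite mul0mx mulmx0 subr0.
  have [sf|sf] := eqVneq (src f) c.
    have := dZ f (idm (tgt f)); rewrite src_idm // eqxx comp_idl // => <-.
    rewrite d1 mulmx0 addr0 infl_idm //; case: eqP => [tf|]; last by rewrite mulmx0.
    by case/endoP: fc.
  have := dZ (idm (src f)) f; rewrite tgt_idm // eqxx comp_idr // => <-.
  by rewrite d1 mul0mx add0r infl_idm // (negPf sf) mul0mx.
set S := \sum_(g in _) _.
have SE : S = #|endo c|%:R *: (delta f *m invmx (sigmaV f)) + sigmaU f *m S *m invmx (sigmaV f).
  rewrite {1}/S -(reindex_translation (endo_translations catC EIC c) _ fc) /rcomp.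
  rewrite mulmx_sumr mulmx_suml scaler_nat -sumr_const -big_split; apply: eq_bigr => g gc /=.
  have /endoP[_ tf] := fc; have /endoP[sg _] := gc.
  have := dZ f g; rewrite tf sg eqxx !inflE fc gc => <-.
  rewrite -(Vrep'.2 f g) // invmx_mul ?Vu // mulmxDl !mulmxA mulmxK ?Vu //.
have := congr1 (mulmx^~ (sigmaV f)) SE.
rewrite mulmxDl -scalemxAl !mulmxKV ?Vu // => SE'.
apply: (scalerI card_c); rewrite scalerBr mulmxN mulNmx -scalemxAr -scalemxAl.
by rewrite !scalerN !scalerA divff // !scale1r opprK SE' addrC addrK.
Qed.

Lemma cocycles_restrict_ker : (Z :&: lker (linfun restrict_Irr))%VS = coboundaries rho tau.
Proof.
have cobZ := subvP (coboundaries_cocycles (infl_cat_rep catC EIC skelC Urep)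
                                          (infl_cat_rep catC EIC skelC Vrep)).
apply/vspaceP => delta; rewrite memv_cap (memv_ker (linfun restrict_Irr)) lfunE /=.
apply/idP/idP; last first.
  move=> dB; rewrite cobZ //=; have /coboundariesP[B ->] := dB.
  apply/eqP/restrict_Irr_eq0 => f fI.
  by rewrite ffunE !(infl_Irr _ _ fI) mul0mx mulmx0 subr0.
move=> /andP[dZ /eqP/restrict_Irr_eq0 dI].
have [cc'|/eqP cc'] := eqVneq c c'; first exact: cocycle_coboundary_same.
(* As [c] and [c'] differ, the coboundary of [B] takes the value [B] at [idm c], so subtracting it
   normalises [delta] there. *)
pose B := delta (idm c).
have BB : coboundary rho tau B \in coboundaries rho tau by apply/coboundariesP; exists B.
suff E : delta - coboundary rho tau B = 0.
  by rewrite -[delta](subrK (coboundary rho tau B)) E add0r.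
have d'Z : delta - coboundary rho tau B \in Z by apply: memvB => //; apply: cobZ.
apply: (cocycle_eq0 d'Z _ _ cc') => [x|f fI]; last first.
  by rewrite !ffunE dI // !(infl_Irr _ _ fI) mul0mx mulmx0 !subr0.
have ccF : (c == c') = false by apply: introF cc'; apply: eqP.
have d'c : (delta - coboundary rho tau B) (idm c) = 0.
  by rewrite !ffunE !infl_idm // eqxx ccF mul1mx mulmx0 subr0 subrr.
have /cocyclesP[d'M _] := d'Z.
have [->//|xc] := eqVneq x c; have [->|xc'] := eqVneq x c'.
  (* The identity for the non-composable pair [idm c], [idm c'] has right side 0 and carries the
     vanishing at [idm c] over to [idm c']. *)
  have := d'M (idm c) (idm c'); rewrite d'c tgt_idm // src_idm // ccF.
  by rewrite !infl_idm // !eqxx mul0mx add0r mul1mx.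
have := d'M (idm x) (idm x); rewrite tgt_idm // src_idm // eqxx !infl_idm //.
by rewrite (negPf xc) (negPf xc') mul0mx mulmx0 addr0 comp_idm.
Qed.

(** Rank-nullity for [restrict_Irr] on the cocycles, whose kernel and image are now known. *)
Lemma dimExt1_intertwiners : dimExt1 rho tau =
  \dim (intertwiners A (kIrr F c c') (tens_dual sigmaU sigmaV)).
Proof.
rewrite /dimExt1 -image_restrict_Irr -cocycles_restrict_ker.
by rewrite -(limg_ker_dim (linfun restrict_Irr) Z) addKn.
Qed.

End Extensions.

Theorem mainTheorem7 (C : fincat) (F : fieldType) :
  is_category C -> is_EI C -> is_skeletal C ->
  (* char k does not divide |C(c,c)| *)
  (forall c : ob C, (#|endo c|)%:R != 0 :> F) ->
  (* k is a splitting field for each C(c,c): every irreducible module has End = k *)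
  (forall (c : ob C) (n : nat) (sigma : arr C -> 'M[F]_n),
     grp_rep c sigma -> simple_on (endo c) sigma ->
     forall B : 'M[F]_n, (forall g, g \in endo c -> sigma g *m B = B *m sigma g) ->
       exists a : F, B = a%:M) ->
  (* vertices: the simple kC-modules are, up to isomorphism, exactly the  *)
  (* inflations of the irreducible C(c,c)-modules, c in C^0, and distinct *)
  (* pairs (c, [U]) give non-isomorphic simple kC-modules                 *)
  ((forall (c : ob C) (n : nat) (sigma : arr C -> 'M[F]_n),
      grp_rep c sigma -> simple_on (endo c) sigma ->
      cat_rep (infl c sigma) /\ simple_on [set: arr C] (infl c sigma)) /\
   (forall (n : nat) (rho : arr C -> 'M[F]_n),
      cat_rep rho -> simple_on [set: arr C] rho ->
      exists (c : ob C) (sigma : arr C -> 'M[F]_n),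
        [/\ grp_rep c sigma, simple_on (endo c) sigma &
            iso_on [set: arr C] rho (infl c sigma)]) /\
   (forall (c c' : ob C) (n n' : nat)
           (sigma : arr C -> 'M[F]_n) (sigma' : arr C -> 'M[F]_n'),
      grp_rep c sigma -> simple_on (endo c) sigma ->
      grp_rep c' sigma' -> simple_on (endo c') sigma' ->
      (iso_on [set: arr C] (infl c sigma) (infl c' sigma') <->
       c = c' /\ iso_on (endo c) sigma sigma'))) /\
  (* arrows: #arrows U -> V = dim Ext^1(U, V) = multiplicity of V (x) U^*  *)
  (* in k[Irr_C(c,c')] as a C(c',c') x C(c,c)-module                     *)
  (forall (c c' : ob C) (n m : nat)
          (sigmaU : arr C -> 'M[F]_n) (sigmaV : arr C -> 'M[F]_m),
     grp_rep c sigmaU -> simple_on (endo c) sigmaU ->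
     grp_rep c' sigmaV -> simple_on (endo c') sigmaV ->
     multiplicity_is (setX (endo c') (endo c))
       (tens_dual sigmaU sigmaV) (kIrr F c c')
       (dimExt1 (infl c sigmaU) (infl c' sigmaV))).
Proof.
move=> catC EIC skelC cardF splitF; split; [split; [|split] |].
- move=> c n sigma srep ss.
  by split; [apply: infl_cat_rep | apply: infl_simple].
- exact: simple_infl.
- by move=> c c' n n' s s' srep [n0 _] srep' _; apply: infl_iso.
move=> c c' n m sigmaU sigmaV Urep Us Vrep Vs.
rewrite (dimExt1_intertwiners catC EIC skelC Urep Vrep) //.
have opA := setX_translations catC EIC c c'.
have cardA : #|setX (endo c') (endo c)|%:R != 0 :> F by rewrite cardsX natrM mulf_neq0.
have Wrep := tens_dual_mat_rep catC EIC Urep Vrep.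
have Wend := tens_dual_end catC EIC Urep Vrep Us Vs (splitF _ _ _ Urep Us) (splitF _ _ _ Vrep Vs).
have Mrep := kIrr_mat_rep F catC EIC skelC c c'.
apply: (multiplicity_is_dim_intertwiners opA) => //.
(* The remaining condition is simplicity of the tensor product, which follows from its scalar
   endomorphisms. *)
apply: (simple_of_scalar_endomorphisms opA) => //.
by rewrite muln_gt0; case: Us => ->; case: Vs => ->.
Qed.
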